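(* Let $\alpha_1,\alpha_2>0$ and $\lambda_1,\lambda_2\ge 0$ be real numbers, set $\alpha^+=\alpha_1+\alpha_2$ and $\lambda^+=\lambda_1+\lambda_2$, and let $X'$ be a random variable with the doubly non-central beta distribution $\mathrm{DNcB}(\alpha_1,\alpha_2,\lambda_1,\lambda_2)$. Then for every integer $r\ge 1$, $$\mathbb{E}\left[(X')^r\right]=\frac{(\alpha_1)_r}{(\alpha^+)_r}\; e^{-\frac{\lambda^+}{2}}\sum_{i=0}^{r}\frac{\binom{r}{i}(\alpha^+)_i\left(\frac{\lambda_1}{2}\right)^i}{(\alpha_1)_i\,(\alpha^++r)_i}\;{}_1F_1\!\left(\alpha^++i;\,\alpha^++r+i;\,\frac{\lambda^+}{2}\right).$$ Here the factor $(\alpha_1)_r/(\alpha^+)_r$ is the $r$-th moment about zero of the $\mathrm{Beta}(\alpha_1,\alpha_2)$ distribution.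
   Context: For $a>0$ and an integer $l\ge 0$, $(a)_l=\Gamma(a+l)/\Gamma(a)$ is the Pochhammer symbol (ascending factorial). ${}_1F_1(a;b;x)=\sum_{i=0}^{\infty}\frac{(a)_i}{(b)_i}\frac{x^i}{i!}$ is Kummer's confluent hypergeometric function. For $g>0$ and $\lambda\ge 0$, the non-central chi-squared distribution $\chi'^{\,2}_g(\lambda)$ is the law of a random variable $Y'$ such that, for some $M\sim\mathrm{Poisson}(\lambda/2)$ ($M=0$ a.s. if $\lambda=0$), $Y'$ given $M$ has the chi-squared distribution with $g+2M$ degrees of freedom. For $\alpha_1,\alpha_2>0$ and $\lambda_1,\lambda_2\ge0$, the doubly non-central beta distribution $\mathrm{DNcB}(\alpha_1,\alpha_2,\lambda_1,\lambda_2)$ is the law of $X'=Y_1'/(Y_1'+Y_2')$ where $Y_1',Y_2'$ are independent with $Y_i'\sim\chi'^{\,2}_{2\alpha_i}(\lambda_i)$. Equivalently, $X'$ given $(M_1,M_2)$ has the $\mathrm{Beta}(\alpha_1+M_1,\alpha_2+M_2)$ distribution, where $M_1,M_2$ are independent with $M_i\sim\mathrm{Poisson}(\lambda_i/2)$. Convention: $0^0=1$. *)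

(* Defs.v *)
From HB Require Import structures.
From mathcomp Require Import all_boot all_order all_algebra.
From mathcomp Require Import all_classical all_reals all_analysis.

Set Implicit Arguments.
Unset Strict Implicit.
Unset Printing Implicit Defensive.

Import Order.TTheory GRing.Theory Num.Theory.
Import numFieldNormedType.Exports.

Local Open Scope classical_set_scope.
Local Open Scope ring_scope.

Definition Gamma {R : realType} (a : R) : R :=
  \int[lebesgue_measure]_(x in `]0%R, +oo[) (x `^ (a - 1) * expR (- x)).

Definition pochhammer {R : realType} (a : R) (l : nat) : R :=
  Gamma (a + l%:R) / Gamma a.

(* Kummer's confluent hypergeometric function 1F1(a; b; x). *)
Definition kummer {R : realType} (a b x : R) : R :=
  limn (series (fun i : nat =>
    pochhammer a i / pochhammer b i * (x ^+ i / i`!%:R))).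

Definition has_law {d d' : measure_display} {T : measurableType d}
    {T' : measurableType d'} {R : realType} (P : probability T R)
    (X : {RV P >-> T'}) (mu : set T' -> \bar R) : Prop :=
  forall A : set T', measurable A -> distribution P X A = mu A.

Definition independent_RVs {d d1 d2 : measure_display} {T : measurableType d}
    {T1 : measurableType d1} {T2 : measurableType d2} {R : realType}
    (P : probability T R) (X : {RV P >-> T1}) (Y : {RV P >-> T2}) : Prop :=
  forall (A : set T1) (B : set T2), measurable A -> measurable B ->
    P (X @^-1` A `&` Y @^-1` B) = (P (X @^-1` A) * P (Y @^-1` B))%E.

Definition chi2_pdf {R : realType} (g x : R) : R :=
  if 0 < x then
    x `^ (g / 2 - 1) * expR (- x / 2) / (2 `^ (g / 2) * Gamma (g / 2))
  else 0.

Definition chi2_law {R : realType} (g : R) (A : set R) : \bar R :=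
  (\int[lebesgue_measure]_(x in A) (chi2_pdf g x)%:E)%E.

(* Y ~ chi'^2_g(l): the last clause says that the conditional law of Y given
   M = k is chi2_law (g + 2k).  The second argument of poisson_prob is a dummy;
   at rate 0, poisson_prob is the Dirac mass at 0 (whereas poisson_pmf is not
   the Poisson mass function there). *)
Definition noncentral_chi2 {d : measure_display} {T : measurableType d}
    {R : realType} (P : probability T R) (Y : {RV P >-> R}) (g l : R) : Prop :=
  exists M : {RV P >-> nat},
    has_law M (poisson_prob (l / 2) 0%N) /\
    (forall (k : nat) (A : set R), measurable A ->
       P (M @^-1` [set k] `&` Y @^-1` A) =
         (P (M @^-1` [set k]) * chi2_law (g + 2 * k%:R) A)%E).

(* DNcB is a law, so Y1, Y2 may live on a probability space other than that
   of X. *)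
Definition DNcB {d : measure_display} {T : measurableType d}
    {R : realType} (P : probability T R) (X : {RV P >-> R})
    (a1 a2 l1 l2 : R) : Prop :=
  exists (d' : measure_display) (T' : measurableType d')
         (P' : probability T' R) (Y1 Y2 : {RV P' >-> R}),
    [/\ noncentral_chi2 Y1 (2 * a1) l1,
        noncentral_chi2 Y2 (2 * a2) l2,
        independent_RVs Y1 Y2 &
        has_law X (fun A => P' [set t | A (Y1 t / (Y1 t + Y2 t))])].

(* The library's beta_prob only covers positive integer parameters. *)
Definition Beta {R : realType} (a b : R) : R :=
  \int[lebesgue_measure]_(x in `]0%R, 1%R[)
    (x `^ (a - 1) * (1 - x) `^ (b - 1)).

Definition beta_density {R : realType} (a b x : R) : R :=
  if 0 < x < 1 then x `^ (a - 1) * (1 - x) `^ (b - 1) / Beta a b else 0.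

Definition beta_law {R : realType} (a b : R) (A : set R) : \bar R :=
  (\int[lebesgue_measure]_(x in A) (beta_density a b x)%:E)%E.

(* Main.v *)
Require Import Defs.
From mathcomp Require Import all_boot all_order all_algebra.
From mathcomp Require Import all_classical all_reals all_analysis.
From mathcomp Require Import measurable_realfun ring lra.

Set Implicit Arguments.
Unset Strict Implicit.
Unset Printing Implicit Defensive.

Import Order.TTheory GRing.Theory Num.Theory.
Import numFieldNormedType.Exports.

Local Open Scope classical_set_scope.
Local Open Scope ring_scope.

(** A variable with the doubly non-central beta distribution is a Poisson
mixture of beta variables: with M1 and M2 independent Poisson variables of
means l1/2 and l2/2, it is Beta(a1 + M1, a2 + M2) given (M1, M2).  Since the
r-th moment of Beta(p, q) is (p)_r / (p + q)_r, the moment wanted is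
<<
   E [ (a1 + M1)_r / (a1 + a2 + M1 + M2)_r ].
>>
The rising factorial in the numerator is expanded by the Chu-Vandermonde
identity in the falling factorials of M1.  The weight of a Poisson law against
the falling factorial of order i is the same law shifted by i, up to the factor
(l1/2)^i, and the sum of M1 and M2 is Poisson of mean (l1 + l2)/2.  So the i-th
term of the expansion is a single series in k = M1 + M2, and this series is
Kummer's function once the rising factorials are regrouped by the rule
(c)_(m+n) = (c)_m (c+m)_n.

Three facts carry the argument.
- [dirichlet_integral]: the double integral of a function of u + v times a
  function of u / (u + v), against u^(p-1) v^(q-1), factors as a gamma-type
  integral times a beta-type integral.  It gives at once the relation between
  Beta and Gamma, hence the beta moments, and the fact that the ratio
  U / (U + V) of independent chi-squared variables is beta distributed.  Its
  proof uses Tonelli and affine changes of one variable.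
- [integral_DNcB]: the mixture representation, in the form of a formula for the
  integral of an arbitrary nonnegative function of X.  It comes from
  conditioning each of the two non-central chi-squared variables on its Poisson
  index, from independence (the joint law is a product measure) and from the
  previous point.
- [mixture_series]: the computation of the resulting double series, done in
  the extended nonnegative reals so that rearrangements are free.

Gamma and Beta are real-valued integrals, equal to 0 when the integral
diverges; convergence and positivity of the gamma integral have therefore to be
established before these functions satisfy any identity.  Convergence for all
a > 0 is deduced, by the recursion G(a+1) = a G(a) of the extended-real
integral, from convergence for a = 1. *)

(** * Affine substitution and a Dirichlet-type formula *)

Local Notation lebesgue := (@lebesgue_measure _).

(** The next two lemmas fix the measurable structure carried by the real line to
the one of the Lebesgue measure; that line has two structures with the same
sets, which unification does not identify. *)
Lemma lebesgue_integralZl (R : realType) (k : \bar R) (f : R -> \bar R) :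
  (0 <= k)%E -> measurable_fun setT f -> (forall x, 0 <= f x)%E ->
  (\int[lebesgue]_x (k * f x) = k * \int[lebesgue]_x f x)%E.
Proof. by move=> k0 mf f0; exact: ge0_integralZl. Qed.

Lemma lebesgue_tonelli (R : realType) (f : R -> R -> \bar R) :
  measurable_fun setT (fun z => f z.1 z.2) -> (forall x y, 0 <= f x y)%E ->
  (\int[lebesgue]_x \int[lebesgue]_y f x y =
   \int[lebesgue]_y \int[lebesgue]_x f x y)%E.
Proof.
move=> mf f0; exact: (@fubini_tonelli _ _ _ _ R lebesgue lebesgue
  (fun z => f z.1 z.2) mf (fun z => f0 z.1 z.2)).
Qed.

(** The identity 1/x = x (x^2)^(-1), with a real power of x^2, also holds at 0,
where both sides are 0. *)
Lemma measurable_invr (R : realType) :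
  measurable_fun [set: R] (fun x : R => x^-1).
Proof.
have -> : (fun x : R => x^-1) = (fun x => x * (x ^+ 2) `^ (-1)).
  apply/funext => x; rewrite powR_inv1 ?sqr_ge0//.
  have [->|x0] := eqVneq x 0; first by rewrite invr0 mul0r.
  by rewrite expr2 invfM mulrA divff// mul1r.
apply: measurable_funM => //.
by apply: (measurableT_comp (@measurable_powR R (-1))); exact: measurable_funX.
Qed.

Lemma measurable_affine (R : realType) (c d : R) :
  measurable_fun [set: R] (fun x : R => c * x + d).
Proof. by apply: measurable_funD => //; exact: measurable_funM. Qed.

(** On half-open intervals, c times the image of the Lebesgue measure under
x |-> c x + d is the Lebesgue measure; uniqueness does the rest. *)
Lemma integral_affine (R : realType) (c d : R) (f : R -> \bar R) : 0 < c ->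
  measurable_fun setT f -> (forall x, 0 <= f x)%E ->
  (\int[lebesgue]_x f x = c%:E * \int[lebesgue]_x f (c * x + d)%R)%E.
Proof.
move=> c0 mf f0.
pose phi (x : measurableTypeR R) : measurableTypeR R := c * x + d.
have mphi : measurable_fun [set: R] phi by exact: measurable_affine.
pose m : {measure set (measurableTypeR R) -> \bar R} :=
  mscale (NngNum (ltW c0)) (pushforward lebesgue phi).
transitivity (\int[m mphi]_x f x)%E.
  apply: eq_measure_integral => A mA _.
  apply: lebesgue_measure_unique => // _ [[a b] _ <-].
  transitivity (c%:E * lebesgue (phi @^-1` `]a, b]%classic))%E; last by [].
  have -> : phi @^-1` `]a, b]%classic = `](a - d) / c, (b - d) / c]%classic.
    apply/seteqP; split => x /=;
      rewrite !in_itv/= /phi ltr_pdivrMr// ler_pdivlMr//;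
      by rewrite [x * c]mulrC ltrBlDr lerBrDr.
  rewrite !lebesgue_measure_itv/= !lte_fin ltr_pM2r ?invr_gt0// ltrD2r.
  case: ifP => _; last by rewrite mule0.
  by rewrite -!EFinM; congr EFin; field; rewrite gt_eqF.
rewrite ge0_integral_mscale//=.
by rewrite ge0_integral_pushforward.
Qed.

Arguments integral_affine {R} c d [f].

(** The power x^(a-1) extended by 0 to the left of the origin.  The exponent is
shifted as in the gamma and beta integrands, and the extension turns all
integrals over half-lines and triangles into integrals over the whole line, to
which Tonelli and affine substitution apply directly. *)
Definition pos_powR (R : realType) (a x : R) : R :=
  if 0 < x then x `^ (a - 1) else 0.

Lemma pos_powR_ge0 (R : realType) (a x : R) : 0 <= pos_powR a x.
Proof. by rewrite /pos_powR; case: ifP => // _; exact: powR_ge0. Qed.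

Lemma measurable_pos_powR (R : realType) (a : R) :
  measurable_fun setT (pos_powR a).
Proof. by apply: measurable_fun_ifT => //; exact: measurable_fun_ltr. Qed.

Lemma pos_powRM (R : realType) (a s x : R) : 0 < s ->
  pos_powR a (s * x) = s `^ (a - 1) * pos_powR a x.
Proof.
move=> s0; rewrite /pos_powR pmulr_rgt0//.
case: ifPn => x0; last by rewrite mulr0.
by rewrite powRM// ltW.
Qed.

Lemma powRD_gt0 (R : realType) (x a b : R) : 0 < x ->
  x `^ (a + b) = x `^ a * x `^ b.
Proof. by move=> x0; rewrite powRD// (gt_eqF x0) implybT. Qed.

Lemma pos_powR_exprn (R : realType) (a x : R) n :
  pos_powR (a + n%:R) x = x ^+ n * pos_powR a x.
Proof.
rewrite /pos_powR; case: ifPn => x0; last by rewrite mulr0.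
rewrite -powR_mulrn ?ltW// -powRD_gt0//; congr (_ `^ _); lra.
Qed.

Section Dirichlet.
Context {R : realType}.
Variables (p q : R) (phi h : R -> R).
Hypotheses (mphi : measurable_fun setT phi) (phi0 : forall x, 0 <= phi x).
Hypotheses (mh : measurable_fun setT h) (h0 : forall x, 0 <= h x).

(** In the inner integral, v is replaced by s = u + v; after Tonelli, u is
replaced by s x in what has become the inner integral.  The powers of s that come
out of the homogeneity of the integrand and of du = s dx add up to p + q - 1. *)
Lemma dirichlet_integral :
  (\int[lebesgue]_u \int[lebesgue]_v
      (pos_powR p u * pos_powR q v * phi (u + v) * h (u / (u + v)))%:E =
   \int[lebesgue]_s (pos_powR (p + q) s * phi s)%:E *
   \int[lebesgue]_x (pos_powR p x * pos_powR q (1 - x) * h x)%:E)%E.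
Proof.
pose F (u s : R) := pos_powR p u * pos_powR q (s - u) * phi s * h (u / s).
have F0 u s : 0 <= F u s by rewrite /F !mulr_ge0 ?pos_powR_ge0.
have mpp (a : R) := measurable_pos_powR a.
have minv := @measurable_invr R.
have mF : measurable_fun setT (fun z : R * R => (F z.1 z.2)%:E).
  apply/measurable_EFinP; apply: measurable_funM; last first.
    apply: (measurableT_comp mh); apply: measurable_funM => //.
    exact: measurableT_comp.
  apply: measurable_funM; last exact: measurableT_comp.
  apply: measurable_funM; first exact: measurableT_comp.
  by apply: (measurableT_comp (mpp q)); exact: measurable_funB.
have mF1 u : measurable_fun setT (fun s => (F u s)%:E).
  exact: (measurableT_comp mF (measurable_pair1 u)).
have mF2 s : measurable_fun setT (fun u => (F u s)%:E).
  exact: (measurableT_comp mF (measurable_pair2 s)).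
have mB : measurable_fun setT
    (fun x => (pos_powR p x * pos_powR q (1 - x) * h x)%:E).
  apply/measurable_EFinP; apply: measurable_funM => //.
  apply: measurable_funM => //; apply: (measurableT_comp (mpp q)).
  exact: measurable_funB.
have B0 x : (0 <= (pos_powR p x * pos_powR q (1 - x) * h x)%:E)%E.
  by rewrite lee_fin !mulr_ge0 ?pos_powR_ge0.
transitivity (\int[lebesgue]_u \int[lebesgue]_s (F u s)%:E)%E.
  apply: eq_integral => u _.
  rewrite [RHS](integral_affine 1 u)//; last by move=> s; rewrite lee_fin.
  rewrite mul1e; apply: eq_integral => v _.
  by rewrite /F mul1r addrK [v + u]addrC.
rewrite lebesgue_tonelli; [|exact: mF|by move=> u s; rewrite lee_fin].
rewrite [RHS]muleC -lebesgue_integralZl; last 3 first.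
- exact: integral_ge0.
- by apply/measurable_EFinP; exact: measurable_funM.
- by move=> s; rewrite lee_fin mulr_ge0// pos_powR_ge0.
apply: eq_integral => s _; rewrite [RHS]muleC.
have [s0|s0] := ltP 0 s; last first.
  rewrite /pos_powR [in RHS]ltNge s0/= mul0r mul0e.
  apply: integral0_eq => u _; rewrite /F /pos_powR.
  case: ifPn => u0; last by rewrite !mul0r.
  by rewrite subr_gt0 ltNge (le_trans s0 (ltW u0))/= mulr0 !mul0r.
rewrite [LHS](integral_affine s 0)//; last by move=> u; rewrite lee_fin.
under eq_integral => x _.
  have -> : F (s * x + 0) s = s `^ (p - 1) * s `^ (q - 1) * phi s *
      (pos_powR p x * pos_powR q (1 - x) * h x).
    rewrite /F addr0 pos_powRM//.
    have -> : s - s * x = s * (1 - x) by ring.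
    rewrite pos_powRM// [s * x]mulrC mulfK ?gt_eqF//; ring.
  rewrite EFinM; over.
rewrite lebesgue_integralZl//; last by rewrite lee_fin !mulr_ge0 ?powR_ge0.
rewrite muleA -EFinM; congr (_%:E * _)%E.
rewrite !mulrA; congr (_ * _); rewrite /pos_powR s0.
rewrite -{1}(powRr1 (ltW s0)) -!powRD_gt0//.
by congr (_ `^ _); ring.
Qed.

End Dirichlet.

(** * The gamma integral *)

(** The gamma integral with values in the extended reals: its identities hold
before one knows that it converges. *)
Definition gamma_integral {R : realType} (a : R) : \bar R :=
  (\int[lebesgue]_x (pos_powR a x * expR (- x))%:E)%E.

Lemma measurable_gamma_integrand (R : realType) (a c : R) :
  measurable_fun setT (fun x : R => (pos_powR a x * expR (- (c * x)))%:E).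
Proof.
apply/measurable_EFinP; apply: measurable_funM; first exact: measurable_pos_powR.
by do 2 apply: measurableT_comp => //; exact: measurable_funM.
Qed.

Lemma gamma_integrand_ge0 (R : realType) (a c x : R) :
  (0 <= (pos_powR a x * expR (- (c * x)))%:E)%E.
Proof. by rewrite lee_fin mulr_ge0 ?pos_powR_ge0 ?expR_ge0. Qed.

Lemma gamma_integral_ge0 (R : realType) (a : R) : (0 <= gamma_integral a)%E.
Proof.
by apply: integral_ge0 => x _; rewrite lee_fin mulr_ge0 ?pos_powR_ge0 ?expR_ge0.
Qed.

Lemma gamma_integral_rate (R : realType) (a c : R) : 0 < c ->
  (\int[lebesgue]_x (pos_powR a x * expR (- (c * x)))%:E =
   (c `^ (- a))%:E * gamma_integral a)%E.
Proof.
move=> c0; have mg := measurable_gamma_integrand a 1.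
have g0 := gamma_integrand_ge0 a 1.
have -> : gamma_integral a =
    (\int[lebesgue]_x (pos_powR a x * expR (- (1 * x)))%:E)%E.
  by rewrite /gamma_integral; under [RHS]eq_integral do rewrite mul1r.
rewrite [in RHS](integral_affine c 0)// muleA -EFinM.
rewrite -lebesgue_integralZl; last 3 first.
- by rewrite lee_fin mulr_ge0 ?powR_ge0// ltW.
- exact: (measurableT_comp mg (measurable_affine c 0)).
- by move=> x; exact: g0.
apply: eq_integral => x _; rewrite -EFinM addr0 mul1r pos_powRM// mulrA.
congr (_ * _)%:E.
rewrite -{2}(powRr1 (ltW c0)) !mulrA -!powRD_gt0//.
by rewrite (_ : - a + 1 + (a - 1) = 0) ?powRr0 ?mul1r//; ring.
Qed.

Lemma integral_expR_tail (R : realType) (x : R) : 0 < x ->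
  (\int[lebesgue]_(t in `[1%R, +oo[) (expR (- (t * x)))%:E =
   (expR (- x) / x)%:E)%E.
Proof.
move=> x0; pose F t := - (expR (- (t * x)) / x).
have dF (t : R) : is_derive t 1 F (expR (- (t * x))).
  apply: is_derive_eq; rewrite /GRing.scale/= !mulr0 ?add0r ?addr0.
  by field; rewrite gt_eqF.
have cE : continuous (fun t : R => expR (- (t * x))).
  move=> t; apply: continuous_comp; last exact: continuous_expR.
  by apply: continuousN; apply: continuousM => //; exact: cst_continuous.
rewrite (@ge0_continuous_FTC2y R _ F _ 0).
- by rewrite sub0e -EFinN opprK mul1r.
- by move=> t _; exact: expR_ge0.
- exact: continuous_subspaceT.
- rewrite /F -oppr0 -(mul0r x^-1); apply: cvgN; apply: cvgM; last exact: cvg_cst.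
  apply: (@cvg_comp _ _ _ (fun t : R => t * x) (fun z : R => expR (- z)) _
    (pinfty_nbhs R)); last exact: cvgr_expR.
  exact: gt0_cvgMly.
- by move=> t _; exact: ex_derive.
- apply: cvgN; apply: cvgM; last exact: cvg_cst.
  by apply/cvg_at_right_filter; exact: cE.
- by move=> t _; rewrite derive1E derive_val.
Qed.

Lemma powR_cvgy0 (R : realType) (a : R) : 0 < a ->
  (t : R) `^ (- a) @[t --> +oo] --> 0.
Proof.
move=> a0.
have : expR (- (a * ln t)) @[t --> +oo] --> (0 : R).
  apply: (@cvg_comp _ _ _ (fun t : R => a * ln t) (fun z : R => expR (- z)) _
    (pinfty_nbhs R)); last exact: cvgr_expR.
  apply: gt0_cvgMry => //; apply/cvgryPge => A.
  near=> t; rewrite -ler_expR lnK ?posrE.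
    by near: t; exact: nbhs_pinfty_ge.
  by near: t; exact: nbhs_pinfty_gt.
apply: cvg_trans; apply: near_eq_cvg; near=> t.
by rewrite /powR gt_eqF ?mulNr//; near: t; exact: nbhs_pinfty_gt.
Unshelve. all: by end_near. Qed.

(** This tail integral of a power provides the factor a in the recursion for the
gamma integral. *)
Lemma integral_powR_tail (R : realType) (a : R) : 0 < a ->
  (\int[lebesgue]_(t in `[1%R, +oo[) (t `^ (- (a + 1)))%:E = (a^-1)%:E)%E.
Proof.
move=> a0; pose F t := - (t `^ (- a) / a).
have dF (t : R) : 0 < t -> is_derive t 1 F (t `^ (- (a + 1))).
  move=> t0; have dP := is_derive1_powR (- a) t0.
  rewrite (_ : F = (- a^-1) \*: (fun s : R => s `^ (- a) : R^o)).
    apply: is_derive_eq.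
    rewrite /GRing.scale/= mulrA mulrNN mulVf ?gt_eqF// mul1r.
    by congr (_ `^ _); ring.
  by apply/funext => s; rewrite /F /= /GRing.scale/= mulNr mulrC.
have cP (b t : R) : 0 < t -> {for t, continuous (fun s : R => s `^ b)}.
  move=> t0; apply/differentiable_continuous/derivable1_diffP.
  by apply: derivable_powR; rewrite in_itv/= t0.
have gt1 (t : R) : 1 <= t -> 0 < t by exact: lt_le_trans.
rewrite (@ge0_continuous_FTC2y R _ F _ 0).
- by rewrite sub0e -EFinN opprK powR1 mul1r.
- by move=> t _; exact: powR_ge0.
- apply: continuous_in_subspaceT => t; rewrite inE/= in_itv/= andbT => t1.
  by apply: cP; exact: gt1.
- rewrite /F -oppr0 -(mul0r a^-1); apply: cvgN; apply: cvgM; last exact: cvg_cst.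
  exact: powR_cvgy0.
- by move=> t /ltW /gt1 /dF dFt; exact: ex_derive.
- apply: cvgN; apply: cvgM; last exact: cvg_cst.
  by apply/cvg_at_right_filter; exact: cP.
- move=> t; rewrite in_itv/= andbT => /ltW /gt1 /dF dFt.
  by rewrite derive1E; exact: derive_val.
Qed.

Lemma integral_ge1 (R : realType) (f : R -> R) :
  (\int[lebesgue]_(t in `[1%R, +oo[) (f t)%:E =
   \int[lebesgue]_t (if 1 <= t then f t else 0)%:E)%E.
Proof.
rewrite integral_mkcond; apply: eq_integral => t _.
by rewrite patchE mem_setE in_itv/= andbT; case: ifP.
Qed.

Lemma measurable_gamma_integrand1 (R : realType) (a : R) :
  measurable_fun setT (fun x : R => (pos_powR a x * expR (- x))%:E).
Proof.
have := measurable_gamma_integrand a 1.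
by apply: eq_measurable_fun => x _; rewrite mul1r.
Qed.

Lemma gamma_integrand1_ge0 (R : realType) (a x : R) :
  (0 <= (pos_powR a x * expR (- x))%:E)%E.
Proof. by rewrite lee_fin mulr_ge0 ?pos_powR_ge0 ?expR_ge0. Qed.

(** Integrate x^a e^(-tx) over x > 0 and t >= 1.  Integrating over x first gives
G(a+1) t^(-a-1), whose integral over t >= 1 is G(a+1) / a; integrating over t
first gives x^a e^(-x) / x, whose integral is G(a).  Compared with an integration
by parts, no boundary term appears at the singularity of x^(a-1) at 0. *)
Lemma gamma_integral_recl (R : realType) (a : R) : 0 < a ->
  (gamma_integral a = (a^-1)%:E * gamma_integral (a + 1))%E.
Proof.
move=> a0.
pose F (t x : R) := if 1 <= t then pos_powR (a + 1) x * expR (- (t * x)) else 0.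
have F0 t x : (0 <= (F t x)%:E)%E.
  rewrite lee_fin /F; case: ifP => // _.
  by rewrite mulr_ge0 ?pos_powR_ge0 ?expR_ge0.
have mge d' (T' : measurableType d') (f : T' -> R) : measurable_fun setT f ->
    measurable_fun setT (fun x => 1 <= f x).
  by move=> mf; exact: measurable_fun_ler.
have mF : measurable_fun setT (fun z : R * R => (F z.1 z.2)%:E).
  apply/measurable_EFinP; apply: measurable_fun_ifT => //; first exact: mge.
  apply: measurable_funM.
    exact: (measurableT_comp (measurable_pos_powR _)).
  by do 2 apply: measurableT_comp => //; exact: measurable_funM.
transitivity (\int[lebesgue]_x \int[lebesgue]_t (F t x)%:E)%E.
  apply: eq_integral => x _.
  have [x0|x0] := ltP 0 x; last first.
    rewrite /pos_powR ltNge x0/= mul0r integral0_eq// => t _.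
    by rewrite /F /pos_powR ltNge x0/= mul0r; case: ifP.
  under eq_integral => t _.
    rewrite (_ : F t x =
      pos_powR (a + 1) x * (if 1 <= t then expR (- (t * x)) else 0)); last first.
      by rewrite /F; case: ifP => // _; rewrite mulr0.
    rewrite EFinM; over.
  rewrite lebesgue_integralZl.
  - rewrite -integral_ge1 integral_expR_tail// -EFinM; congr EFin.
    by rewrite (pos_powR_exprn a x 1) expr1; field; rewrite gt_eqF.
  - by rewrite lee_fin pos_powR_ge0.
  - apply/measurable_EFinP; apply: measurable_fun_ifT => //; first exact: mge.
    by do 2 apply: measurableT_comp => //; exact: measurable_funM.
  - by move=> t; rewrite lee_fin; case: ifP => // _; exact: expR_ge0.
rewrite -lebesgue_tonelli//.
pose K (t : R) := (if 1 <= t then t `^ (- (a + 1)) else 0)%:E.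
have FK (t : R) : (\int[lebesgue]_x (F t x)%:E = gamma_integral (a + 1) * K t)%E.
  rewrite /K /F; case: ifPn => t1; last by rewrite mule0 integral0.
  have t0 : 0 < t by exact: lt_le_trans t1.
  by rewrite (gamma_integral_rate _ t0) muleC.
transitivity (\int[lebesgue]_t (gamma_integral (a + 1) * K t))%E.
  by apply: eq_integral => t _; exact: FK.
rewrite lebesgue_integralZl.
- by rewrite /K -integral_ge1 integral_powR_tail// muleC.
- exact: gamma_integral_ge0.
- by apply/measurable_EFinP; apply: measurable_fun_ifT => //; exact: mge.
- by move=> t; rewrite lee_fin; case: ifP => // _; exact: powR_ge0.
Qed.

Lemma gamma_integralS (R : realType) (a : R) : 0 < a ->
  (gamma_integral (a + 1) = a%:E * gamma_integral a)%E.
Proof.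
move=> a0; rewrite [in RHS]gamma_integral_recl// muleA -EFinM.
by rewrite divff ?gt_eqF// mul1e.
Qed.

Lemma gamma_integral1_lty (R : realType) : (gamma_integral (1 : R) < +oo)%E.
Proof.
apply: (@le_lt_trans _ _ 1%E); last exact: ltry.
rewrite -(@integral_exponential_pdf R 1)//; apply: ge0_le_integral => //.
- by move=> x _; exact: gamma_integrand1_ge0.
- exact: measurable_gamma_integrand1.
- by apply/measurable_EFinP; exact: measurable_exponential_pdf.
- move=> x _; rewrite lee_fin /pos_powR; case: ifPn => x0; last first.
    by rewrite mul0r exponential_pdf_ge0.
  by rewrite subrr powRr0 (exponential_pdfE _ (ltW x0)) mulN1r.
Qed.

Lemma gamma_integralSn_lty (R : realType) n :
  (gamma_integral (n.+1%:R : R) < +oo)%E.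
Proof.
elim: n => [|n IH]; first exact: gamma_integral1_lty.
rewrite -natr1 gamma_integralS// lte_mul_pinfty// gamma_integral_ge0.
Qed.

(** By the recursion it is enough to bound G(a+1).  If n is an integer above a,
then x^a <= 1 + x^n for x > 0, so that G(a+1) <= G(1) + G(n+1). *)
Lemma gamma_integral_fin_num (R : realType) (a : R) : 0 < a ->
  gamma_integral a \is a fin_num.
Proof.
move=> a0; rewrite ge0_fin_numE ?gamma_integral_ge0// gamma_integral_recl//.
rewrite lte_mul_pinfty ?lee_fin ?invr_ge0 ?ltW//.
have [n an] : exists n : nat, a <= n%:R.
  by exists (Num.bound a); rewrite ltW// archi_boundP// ltW.
apply: (@le_lt_trans _ _ (gamma_integral 1 + gamma_integral n.+1%:R)%E); last first.
  by rewrite lte_add_pinfty ?gamma_integral1_lty ?gamma_integralSn_lty.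
rewrite -ge0_integralD//; last 4 first.
- by move=> x _; exact: gamma_integrand1_ge0.
- exact: measurable_gamma_integrand1.
- by move=> x _; exact: gamma_integrand1_ge0.
- exact: measurable_gamma_integrand1.
apply: ge0_le_integral => //.
- by move=> x _; exact: gamma_integrand1_ge0.
- exact: measurable_gamma_integrand1.
- by apply: emeasurable_funD; exact: measurable_gamma_integrand1.
move=> x _; rewrite -EFinD lee_fin -mulrDl ler_wpM2r ?expR_ge0// /pos_powR.
case: ifPn => x0; last by rewrite addr0.
rewrite -[n.+1%:R]natr1 !addrK subrr powRr0.
have [x1|x1] := leP 1 x.
  by rewrite -[leLHS]add0r lerD// ler_powR.
have xa1 : x `^ a <= 1 by rewrite -[leRHS](powRr0 x) ger_powR ?(ltW a0)// x0 ltW.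
by rewrite -[leLHS]addr0 lerD ?powR_ge0.
Qed.

(** On the interval from 1 to 2 the integrand is at least e^(-2) / 2, because
x^(a-1) >= x^(-1) there. *)
Lemma gamma_integral_gt0 (R : realType) (a : R) : 0 < a ->
  (0 < gamma_integral a)%E.
Proof.
move=> a0; pose c : R := 2^-1 * expR (- 2).
have c0 : 0 < c by rewrite mulr_gt0 ?expR_gt0.
apply: (@lt_le_trans _ _ (\int[lebesgue]_(x in `[1%R, 2%R]) c%:E)%E).
  rewrite integral_cst//= lebesgue_measure_itv/= lte_fin ltr1n.
  by rewrite -EFinD -EFinM lte_fin mulr_gt0// subr_gt0 ltr1n.
apply: (@le_trans _ _ (\int[lebesgue]_(x in `[1%R, 2%R])
    (pos_powR a x * expR (- x))%:E)%E); last first.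
  apply: ge0_subset_integral => //; first exact: measurable_gamma_integrand1.
  by move=> x _; exact: gamma_integrand1_ge0.
apply: ge0_le_integral => //.
- by move=> x _; rewrite lee_fin ltW.
- by apply: measurable_funTS; exact: measurable_gamma_integrand1.
move=> x /=; rewrite in_itv/= => /andP[x1 x2].
have x0 : 0 < x by exact: lt_le_trans x1.
rewrite lee_fin ler_pM ?expR_ge0 ?ler_expR ?lerN2// /pos_powR x0.
apply: (@le_trans _ _ (x `^ (-1))); last by rewrite ler_powR//; lra.
by rewrite (powR_inv1 (ltW x0)) lef_pV2 ?posrE.
Qed.

Lemma gamma_integralE (R : realType) (a : R) : 0 < a ->
  gamma_integral a = (Gamma a)%:E.
Proof.
move=> a0; rewrite -(fineK (gamma_integral_fin_num a0)); congr EFin.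
rewrite /Gamma /Rintegral integral_mkcond; congr fine; apply: eq_integral => x _.
rewrite patchE mem_setE in_itv/= andbT /pos_powR; case: ifP => //.
by rewrite mul0r.
Qed.

Lemma Gamma_gt0 (R : realType) (a : R) : 0 < a -> 0 < Gamma a.
Proof. by move=> a0; rewrite -lte_fin -gamma_integralE// gamma_integral_gt0. Qed.

Lemma GammaS (R : realType) (a : R) : 0 < a -> Gamma (a + 1) = a * Gamma a.
Proof.
move=> a0; have a10 : 0 < a + 1 by rewrite addr_gt0.
by apply: EFin_inj; rewrite EFinM -!gamma_integralE// gamma_integralS.
Qed.

(** * Rising factorials *)

Section pochhammer.
Context {R : realType}.
Implicit Types (a : R) (m n : nat).

Lemma pochhammer0 a : 0 < a -> pochhammer a 0 = 1.
Proof. by move=> a0; rewrite /pochhammer addr0 divff// gt_eqF ?Gamma_gt0. Qed.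

Lemma pochhammer_gt0 a n : 0 < a -> 0 < pochhammer a n.
Proof. by move=> a0; rewrite divr_gt0 ?Gamma_gt0// ltr_wpDr. Qed.

Lemma GammaDn a n : 0 < a -> Gamma (a + n%:R) = Gamma a * pochhammer a n.
Proof. by move=> a0; rewrite mulrC divfK// gt_eqF ?Gamma_gt0. Qed.

(** This splitting rule is behind every later regrouping of rising factorials. *)
Lemma pochhammerD a m n : 0 < a ->
  pochhammer a (m + n) = pochhammer a m * pochhammer (a + m%:R) n.
Proof.
move=> a0; have am : 0 < a + m%:R by rewrite ltr_wpDr.
have := Gamma_gt0 am; rewrite /pochhammer natrD addrA => g.
by rewrite [RHS]mulrC mulrA divfK// gt_eqF.
Qed.

Lemma pochhammer1 a : 0 < a -> pochhammer a 1 = a.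
Proof. by move=> a0; rewrite /pochhammer GammaS// mulfK// gt_eqF ?Gamma_gt0. Qed.

Lemma pochhammerS a n : 0 < a -> pochhammer a n.+1 = a * pochhammer (a + 1) n.
Proof. by move=> a0; rewrite -add1n pochhammerD// pochhammer1. Qed.

Lemma pochhammerSr a n : 0 < a ->
  pochhammer a n.+1 = pochhammer a n * (a + n%:R).
Proof.
by move=> a0; rewrite -addn1 pochhammerD// pochhammer1// ltr_wpDr.
Qed.

End pochhammer.

Opaque Gamma pochhammer.

(** * The beta integral *)

Section beta.
Context {R : realType}.
Implicit Types p q : R.

Definition beta_kernel p q (x : R) := pos_powR p x * pos_powR q (1 - x).

Lemma beta_kernel_ge0 p q x : 0 <= beta_kernel p q x.
Proof. by rewrite mulr_ge0 ?pos_powR_ge0. Qed.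

Lemma measurable_beta_kernel p q : measurable_fun setT (beta_kernel p q).
Proof.
apply: measurable_funM; first exact: measurable_pos_powR.
apply: (measurableT_comp (measurable_pos_powR q)); exact: measurable_funB.
Qed.

(** The Dirichlet-type formula for the weight e^(-(u+v)): the double integral is
then a product of two gamma integrals. *)
Lemma integral_beta_kernel p q : 0 < p -> 0 < q ->
  (\int[lebesgue]_x (beta_kernel p q x)%:E =
   (Gamma p * Gamma q / Gamma (p + q))%:E)%E.
Proof.
move=> p0 q0; have pq0 : 0 < p + q by rewrite addr_gt0.
have mE : measurable_fun setT (fun s : R => expR (- s)) by exact: measurableT_comp.
have m1 : measurable_fun [set: R] (fun=> 1 : R) by [].
have := dirichlet_integral p q mE (fun=> expR_ge0 _) m1 (fun=> ler01).
rewrite -/(gamma_integral (p + q)) gamma_integralE//.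
under eq_integral => u _.
  under eq_integral => v _.
    rewrite (_ : _ * 1 =
      pos_powR p u * expR (- u) * (pos_powR q v * expR (- v))); last first.
      by rewrite mulr1 opprD expRD; ring.
    rewrite EFinM; over.
  rewrite lebesgue_integralZl; last 3 first.
  - exact: gamma_integrand1_ge0.
  - exact: measurable_gamma_integrand1.
  - by move=> v; exact: gamma_integrand1_ge0.
  rewrite -/(gamma_integral q) muleC; over.
rewrite lebesgue_integralZl; last 3 first.
- exact: gamma_integral_ge0.
- exact: measurable_gamma_integrand1.
- by move=> v; exact: gamma_integrand1_ge0.
rewrite -/(gamma_integral p) !gamma_integralE// -EFinM.
under [X in _ = (_ * X)%E -> _]eq_integral do rewrite mulr1.
set I := integral _ _ _; move=> H; rewrite -[LHS]/I.
have g0 : Gamma (p + q) != 0 by rewrite gt_eqF ?Gamma_gt0.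
by rewrite -[I]mul1e -(mulVf g0) EFinM -muleA -H -EFinM mulrC (mulrC (Gamma q)).
Qed.

Lemma BetaE p q : 0 < p -> 0 < q -> Beta p q = Gamma p * Gamma q / Gamma (p + q).
Proof.
move=> p0 q0; apply: EFin_inj; rewrite -integral_beta_kernel// /Beta /Rintegral.
have -> : (\int[lebesgue]_(x in `]0%R, 1%R[)
      (x `^ (p - 1) * (1 - x) `^ (q - 1))%:E =
    \int[lebesgue]_x (beta_kernel p q x)%:E)%E.
  rewrite integral_mkcond; apply: eq_integral => x _.
  rewrite patchE mem_setE in_itv/= /beta_kernel /pos_powR subr_gt0.
  by case: (ltP 0 x) => _; case: (ltP x 1) => _ /=; rewrite ?mul0r ?mulr0.
by rewrite integral_beta_kernel.
Qed.

Lemma beta_densityE p q x : beta_density p q x = beta_kernel p q x / Beta p q.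
Proof.
rewrite /beta_density /beta_kernel /pos_powR subr_gt0.
by case: (ltP 0 x) => _; case: (ltP x 1) => _ /=; rewrite ?mul0r ?mulr0 ?mul0r.
Qed.

(** Multiplying the beta kernel by x^n shifts its first parameter by n. *)
Lemma beta_moment p q n : 0 < p -> 0 < q ->
  (\int[lebesgue]_x (x ^+ n * beta_density p q x)%:E =
   (pochhammer p n / pochhammer (p + q) n)%:E)%E.
Proof.
move=> p0 q0; have pq0 : 0 < p + q by rewrite addr_gt0.
have pn0 : 0 < p + n%:R by rewrite ltr_wpDr.
have pqn0 : 0 < p + q + n%:R by rewrite ltr_wpDr.
have B0 : 0 < Beta p q by rewrite BetaE// divr_gt0 ?mulr_gt0 ?Gamma_gt0.
under eq_integral => x _.
  rewrite (_ : x ^+ n * _ = (Beta p q)^-1 * beta_kernel (p + n%:R) q x); last first.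
    by rewrite beta_densityE /beta_kernel pos_powR_exprn; ring.
  rewrite EFinM; over.
rewrite lebesgue_integralZl; last 3 first.
- by rewrite lee_fin invr_ge0 ltW.
- by apply/measurable_EFinP; exact: measurable_beta_kernel.
- by move=> x; rewrite lee_fin beta_kernel_ge0.
rewrite integral_beta_kernel// -EFinM BetaE// addrAC !GammaDn//; congr EFin.
have := Gamma_gt0 p0; have := Gamma_gt0 q0; have := Gamma_gt0 pq0.
have := pochhammer_gt0 n pq0; move: (Gamma p) (Gamma q) (Gamma (p + q)).
move: (pochhammer p n) (pochhammer (p + q) n) => A1 A2 A3 A4 A5 *.
by field; rewrite !gt_eqF.
Qed.

End beta.

(** * The Chu-Vandermonde identity *)

Lemma pochhammer_shift (R : realType) (a : R) k : 0 < a ->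
  pochhammer (a + 1) k.+1 = pochhammer a k.+1 + k.+1%:R * pochhammer (a + 1) k.
Proof.
move=> a0; have a10 : 0 < a + 1 by rewrite addr_gt0.
by rewrite pochhammerSr// pochhammerS// -natr1; ring.
Qed.

Lemma ffactS_pascal m i : (m.+1 ^_ i.+1 = m ^_ i.+1 + i.+1 * m ^_ i)%N.
Proof.
rewrite ffactSS ffactnSr; have [im|mi] := leqP i m.
  by rewrite [(_ * (m - i))%N]mulnC -mulnDl addnS subnK.
by rewrite ffact_small// !muln0.
Qed.

(** Chu-Vandermonde, by induction on m with a varying.  Passing from a to a + 1
in the factor (a+i)_(r-i) adds (r-i) (a+i+1)_(r-i-1), and passing from m to m + 1
in the falling factorial of order i+1 adds i + 1 times that of order i; the two
corrections agree because (i+1) C(r,i+1) = (r-i) C(r,i). *)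
Lemma pochhammer_vandermonde (R : realType) (a : R) m r : 0 < a ->
  pochhammer (a + m%:R) r =
  \sum_(i < r.+1) ('C(r, i) * m ^_ i)%:R * pochhammer (a + i%:R) (r - i).
Proof.
elim: m a => [|m IH] a a0.
  rewrite big_ord_recl/= bin0 ffactn0 mul1r subn0 big1 ?addr0// => i _.
  by rewrite /= ffact0n muln0 mul0r.
rewrite -natr1 [m%:R + 1]addrC addrA IH ?addr_gt0//.
(* The common value is written as the sum at m plus one correction sum. *)
pose t1 i := ('C(r, i) * m ^_ i)%:R * pochhammer (a + i%:R) (r - i).
pose t2 i := ('C(r, i.+1) * (i.+1 * m ^_ i))%:R *
  pochhammer (a + i.+1%:R) (r - i.+1).
transitivity (\sum_(i < r.+1) t1 i + \sum_(i < r) t2 i).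
  rewrite [in RHS]big_ord_recr/= [in LHS]big_ord_recr/= [RHS]addrAC -big_split/=.
  congr (_ + _); last by rewrite /t1 subnn !pochhammer0// ltr_wpDr// addr_gt0.
  apply: eq_bigr => i _; rewrite /t1 /t2.
  have -> : (r - i = (r - i.+1).+1)%N by rewrite -subSn.
  rewrite addrAC pochhammer_shift ?ltr_wpDr// mulrDr; congr (_ + _).
  rewrite mulrA -natrM -addrA natr1; congr (_%:R * _).
  rewrite -subSn// subSS.
  by rewrite mulnA [('C(r, i.+1) * _)%N]mulnC mul_bin_left [LHS]mulnC mulnA.
rewrite [in RHS]big_ord_recl/= [in LHS]big_ord_recl/= -addrA -big_split/=.
congr (_ + _); apply: eq_bigr => i _; rewrite /t1 /t2 /bump/= add1n.
by rewrite ffactS_pascal mulnDr natrD mulrDl.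
Qed.

(** * Series of nonnegative terms *)

Section series.
Local Open Scope ereal_scope.
Context {R : realType}.

(** Summation along antidiagonals: the n-sum is shifted by m, after which the two
sums have independent ranges and are interchanged. *)
Lemma nneseries_diagonal (f : nat -> nat -> \bar R) :
  (forall m n, 0 <= f m n) ->
  \sum_(m <oo) \sum_(n <oo) f m n =
  \sum_(k <oo) \sum_(m < k.+1) f m (k - m)%N.
Proof.
move=> f0; pose g m k := if (m <= k)%N then f m (k - m)%N else 0.
have g0 m k : 0 <= g m k by rewrite /g; case: ifP.
transitivity (\sum_(m <oo) \sum_(k <oo) g m k).
  apply: eq_eseriesr => m _.
  rewrite [RHS](nneseries_split 0 m)// add0n.
  rewrite [X in _ = X + _]big_nat_cond big1 ?add0e; last first.
    by move=> k; rewrite andbT leq0n andTb => km; rewrite /g leqNgt km.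
  rewrite -[RHS]nneseries_addn//; apply: eq_eseriesr => n _.
  by rewrite /g leq_addl addnK.
rewrite nneseries_interchange//; apply: eq_eseriesr => k _.
rewrite (nneseries_split 0 k.+1)// add0n [X in _ + X]eseries0 ?adde0; last first.
  by move=> m km _; rewrite /g leqNgt km.
rewrite big_mkord; apply: eq_bigr => m _.
by rewrite /g -ltnS ltn_ord.
Qed.

(** The sum of two independent Poisson variables is Poisson, up to normalization. *)
Lemma nneseries_exp_conv (x y : R) (w : nat -> R) : (0 <= x)%R -> (0 <= y)%R ->
  (forall n, 0 <= w n)%R ->
  \sum_(m <oo) \sum_(n <oo)
    (x ^+ m / m`!%:R * (y ^+ n / n`!%:R) * w (m + n)%N)%:E =
  \sum_(k <oo) ((x + y) ^+ k / k`!%:R * w k)%:E.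
Proof.
move=> x0 y0 w0; rewrite nneseries_diagonal; last first.
  by move=> m n; rewrite lee_fin !mulr_ge0 ?exprn_ge0.
apply: eq_eseriesr => k _; rewrite sumEFin addrC exprDn !mulr_suml.
congr EFin; apply: eq_bigr => -[m/= mk] _; rewrite ltnS in mk.
rewrite subnKC// -(bin_fact mk) -mulr_natr !natrM.
by field; rewrite !pnatr_eq0 -!lt0n !fact_gt0 bin_gt0 mk.
Qed.

(** Against a falling factorial of order i, the exponential weights x^m / m! are
shifted by i: the first i terms vanish, and the others simplify. *)
Lemma nneseries_ffact (x : R) (g : nat -> \bar R) i : (0 <= x)%R ->
  (forall n, 0 <= g n) ->
  \sum_(m <oo) ((m ^_ i)%:R * (x ^+ m / m`!%:R))%:E * g m =
  \sum_(m <oo) (x ^+ i * (x ^+ m / m`!%:R))%:E * g (m + i)%N.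
Proof.
move=> x0 g0.
have h0 m : 0 <= ((m ^_ i)%:R * (x ^+ m / m`!%:R))%:E * g m.
  by rewrite mule_ge0// lee_fin !mulr_ge0 ?exprn_ge0.
rewrite [LHS](nneseries_split 0 i)// add0n.
rewrite [X in X + _]big_nat_cond big1 ?add0e; last first.
  move=> m; rewrite andbT leq0n andTb => mi.
  by rewrite ffact_small// mul0r mul0e.
rewrite -[LHS]nneseries_addn//; apply: eq_eseriesr => m _; congr (_%:E * _).
have := ffact_fact (leq_addl m i); rewrite addnK => <-.
rewrite natrM exprD.
by field; rewrite !pnatr_eq0 -!lt0n fact_gt0 ffact_gt0 leq_addl.
Qed.

Lemma pochhammer_le (a b : R) n : (0 < a)%R -> (a <= b)%R ->
  (pochhammer a n <= pochhammer b n)%R.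
Proof.
move=> a0 ab; have b0 := lt_le_trans a0 ab.
elim: n => [|n IH]; first by rewrite !pochhammer0.
rewrite (pochhammerSr _ a0) (pochhammerSr _ b0); apply: ler_pM => //.
- exact/ltW/pochhammer_gt0.
- by rewrite addr_ge0// ltW.
- by rewrite lerD2r.
Qed.

(** For a <= b the coefficients are at most 1, so the series is dominated by the
exponential series; convergence makes the real limit equal to the sum. *)
Lemma kummerE (a b x : R) : (0 < a)%R -> (a <= b)%R -> (0 <= x)%R ->
  \sum_(i <oo) (pochhammer a i / pochhammer b i * (x ^+ i / i`!%:R))%:E =
  (kummer a b x)%:E.
Proof.
move=> a0 ab x0; have b0 := lt_le_trans a0 ab.
have t0 i : (0 <= pochhammer a i / pochhammer b i * (x ^+ i / i`!%:R))%R.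
  have pa := ltW (pochhammer_gt0 i a0); have pb := ltW (pochhammer_gt0 i b0).
  by apply: mulr_ge0; apply: divr_ge0 => //; exact: exprn_ge0.
pose u := (fun i : nat => pochhammer a i / pochhammer b i * (x ^+ i / i`!%:R))%R.
have cu : cvgn (series u).
  apply: (series_le_cvg t0 _ _ (is_cvg_series_exp_coeff x)).
    by move=> i; rewrite divr_ge0 ?exprn_ge0.
  move=> i; rewrite /exp_coeff/= -[leRHS]mul1r ler_wpM2r ?divr_ge0 ?exprn_ge0//.
  by rewrite ler_pdivrMr ?pochhammer_gt0// mul1r pochhammer_le.
rewrite /kummer -/u -EFin_lim//.
by apply/congr_lim/funext => n; rewrite /= -sumEFin.
Qed.

End series.

(** * Rising factorials averaged over two Poisson laws *)

(** Unlike [poisson_pmf], this is the mass function of the Poisson law at rate 0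
too, where it is concentrated at 0. *)
Definition poisson_weight {R : realType} (x : R) (n : nat) : R :=
  x ^+ n / n`!%:R * expR (- x).

Lemma poisson_weight_ge0 (R : realType) (x : R) n : 0 <= x ->
  0 <= poisson_weight x n.
Proof.
by move=> x0; apply: mulr_ge0; rewrite ?expR_ge0// divr_ge0// exprn_ge0.
Qed.

Section mixture_series.
Context {R : realType}.
Variables (a b x y : R) (r : nat).
Hypotheses (a0 : 0 < a) (b0 : 0 < b) (x0 : 0 <= x) (y0 : 0 <= y).
Let c := a + b.
Let c0 : 0 < c. Proof. exact: addr_gt0. Qed.
Let w (n : nat) : R := (pochhammer (c + n%:R) r)^-1.
Let w0 n : 0 <= w n.
Proof. by rewrite invr_ge0 ltW// pochhammer_gt0// ltr_wpDr. Qed.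

(** The two properties of exponential weights combined: the falling factorial
shifts the first index, then the two indices merge into their sum. *)
Let factorial_moment i :
  (\sum_(m <oo) \sum_(n <oo)
     ((m ^_ i)%:R * (x ^+ m / m`!%:R) * (y ^+ n / n`!%:R * w (m + n)%N))%:E =
   (x ^+ i)%:E * \sum_(k <oo) ((x + y) ^+ k / k`!%:R * w (k + i)%N)%:E)%E.
Proof.
pose g m := (\sum_(n <oo) (y ^+ n / n`!%:R * w (m + n)%N)%:E)%E.
have gt0 m n : (0 <= (y ^+ n / n`!%:R * w (m + n)%N)%:E)%E.
  by rewrite lee_fin; apply: mulr_ge0 => //; rewrite divr_ge0// exprn_ge0.
have g0 m : (0 <= g m)%E by exact: nneseries_ge0.
transitivity (\sum_(m <oo) ((m ^_ i)%:R * (x ^+ m / m`!%:R))%:E * g m)%E.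
  apply: eq_eseriesr => m _; rewrite /g -nneseriesZl//.
rewrite nneseries_ffact//.
transitivity (\sum_(m <oo) (x ^+ i)%:E * \sum_(n <oo)
   (x ^+ m / m`!%:R * (y ^+ n / n`!%:R) * w (m + n + i)%N)%:E)%E.
  apply: eq_eseriesr => m _; rewrite /g EFinM -muleA; congr (_ * _)%E.
  rewrite -nneseriesZl//; apply: eq_eseriesr => n _.
  by rewrite -EFinM (addnAC m i n); congr EFin; ring.
rewrite nneseriesZl; last first.
  move=> m _; apply: nneseries_ge0 => n _ _; rewrite lee_fin.
  by apply: mulr_ge0 => //; apply: mulr_ge0; rewrite divr_ge0// exprn_ge0.
by rewrite (nneseries_exp_conv (w := fun n => w (n + i)%N) x0 y0).
Qed.

(** The term of index k in the i-th expansion is the k-th coefficient of a Kummer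
series: split (a)_r at i, (c)_(i+k) and (c+r)_(i+k) at i, and split (c)_(r+i+k) in
two ways, at r and at i + k. *)
Let coefficientE i k : (i <= r)%N ->
  'C(r, i)%:R * pochhammer (a + i%:R) (r - i) * w (k + i)%N =
  pochhammer a r / pochhammer c r *
  ('C(r, i)%:R * pochhammer c i / (pochhammer a i * pochhammer (c + r%:R) i)) *
  (pochhammer (c + i%:R) k / pochhammer (c + r%:R + i%:R) k).
Proof.
move=> ir.
have cr0 : 0 < c + r%:R by rewrite ltr_wpDr.
have cri0 : 0 < c + r%:R + i%:R by rewrite ltr_wpDr.
have ck0 : 0 < c + (i + k)%:R by rewrite ltr_wpDr.
have ci0 : 0 < c + i%:R by rewrite ltr_wpDr.
have ai : pochhammer a r = pochhammer a i * pochhammer (a + i%:R) (r - i).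
  by rewrite -(pochhammerD _ _ a0) subnKC.
have ci := pochhammerD i k c0.
have cri := pochhammerD i k cr0.
have swap : pochhammer c r * pochhammer (c + r%:R) (i + k) =
    pochhammer c (i + k) * pochhammer (c + (i + k)%:R) r.
  by rewrite -(pochhammerD r _ c0) -(pochhammerD _ r c0) addnC.
have p1 := pochhammer_gt0 i a0.
have p2 := pochhammer_gt0 r c0.
have p3 := pochhammer_gt0 i cr0.
have p4 := pochhammer_gt0 k cri0.
have p5 := pochhammer_gt0 r ck0.
have p6 := pochhammer_gt0 i c0.
have p7 := pochhammer_gt0 k ci0.
rewrite /w addnC ai; rewrite ci cri in swap.
move: p1 p2 p3 p4 p5 p6 p7 swap.
move: (pochhammer a i) (pochhammer c r) (pochhammer (c + r%:R) i)
  (pochhammer (c + r%:R + i%:R) k) (pochhammer (c + (i + k)%:R) r)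
  (pochhammer c i) (pochhammer (c + i%:R) k) (pochhammer (a + i%:R) (r - i)).
move=> A1 A2 A3 A4 A5 A6 A7 A8 p1 p2 p3 p4 p5 p6 p7 swap.
have -> : A5^-1 = A6 * A7 / (A2 * (A3 * A4)).
  by rewrite swap invfM mulrA divff ?mul1r// mulf_neq0 ?gt_eqF.
by field; rewrite !gt_eqF.
Qed.

(** The Chu-Vandermonde expansion of the numerator makes the summand a finite sum
over i, which is exchanged with the two series; each i then contributes a Kummer
series. *)
Lemma mixture_series :
  (\sum_(m <oo) \sum_(n <oo)
     (poisson_weight x m * poisson_weight y n *
      (pochhammer (a + m%:R) r /
       pochhammer (a + m%:R + (b + n%:R)) r))%:E =
   (pochhammer a r / pochhammer c r * expR (- (x + y)) *
    \sum_(i < r.+1)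
       ('C(r, i)%:R * pochhammer c i * x ^+ i /
        (pochhammer a i * pochhammer (c + r%:R) i) *
        kummer (c + i%:R) (c + r%:R + i%:R) (x + y)))%:E)%E.
Proof.
pose K i := expR (- (x + y)) * ('C(r, i)%:R * pochhammer (a + i%:R) (r - i)).
have K0 i : 0 <= K i.
  apply: mulr_ge0; first exact: expR_ge0.
  by apply: mulr_ge0 => //; apply/ltW/pochhammer_gt0; rewrite ltr_wpDr.
pose t i m n : R :=
  (m ^_ i)%:R * (x ^+ m / m`!%:R) * (y ^+ n / n`!%:R * w (m + n)%N).
have t0 i m n : 0 <= t i m n.
  by rewrite /t mulr_ge0// mulr_ge0// divr_ge0// exprn_ge0.
transitivity (\sum_(i < r.+1) (K i)%:E *
    \sum_(m <oo) \sum_(n <oo) (t i m n)%:E)%E.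
  transitivity (\sum_(m <oo) \sum_(n <oo) \sum_(i < r.+1) (K i * t i m n)%:E)%E.
    apply: eq_eseriesr => m _; apply: eq_eseriesr => n _; rewrite sumEFin.
    congr EFin; rewrite pochhammer_vandermonde// mulr_suml mulr_sumr.
    apply: eq_bigr => i _; rewrite /K /t /w natrD natrM.
    rewrite (_ : a + m%:R + (b + n%:R) = c + (m%:R + n%:R)); last first.
      by rewrite /c; ring.
    by rewrite /poisson_weight opprD expRD; ring.
  transitivity (\sum_(m <oo) \sum_(i < r.+1)
      (K i)%:E * \sum_(n <oo) (t i m n)%:E)%E.
    apply: eq_eseriesr => m _; rewrite nneseries_sum; last first.
      by move=> i n _; rewrite lee_fin mulr_ge0.
    apply: eq_bigr => i _; rewrite -nneseriesZl//.
    by move=> n _; rewrite lee_fin.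
  rewrite nneseries_sum; last first.
    move=> i m _; rewrite mule_ge0 ?lee_fin//; apply: nneseries_ge0 => n _ _.
    by rewrite lee_fin.
  apply: eq_bigr => i _; rewrite nneseriesZl// => m _.
  by apply: nneseries_ge0 => n _ _; rewrite lee_fin.
rewrite mulr_sumr -sumEFin; apply: eq_bigr => -[i/= ir] _; rewrite ltnS in ir.
rewrite factorial_moment muleA -EFinM.
(* The factor of the i-th Kummer series in the right-hand side. *)
pose A := pochhammer a r / pochhammer c r * expR (- (x + y)) *
  ('C(r, i)%:R * pochhammer c i / (pochhammer a i * pochhammer (c + r%:R) i)) *
  x ^+ i.
transitivity (\sum_(k <oo) A%:E * (pochhammer (c + i%:R) k /
    pochhammer (c + r%:R + i%:R) k * ((x + y) ^+ k / k`!%:R))%:E)%E.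
  rewrite -nneseriesZl; last first.
    by move=> k _; rewrite lee_fin mulr_ge0// divr_ge0// exprn_ge0// addr_ge0.
  apply: eq_eseriesr => k _; rewrite -!EFinM; congr EFin.
  rewrite /K /A; have := coefficientE k ir.
  set B := _ * pochhammer _ (r - i); set v := w (k + i) => E.
  have regroup (t1 t2 t3 t4 t5 : R) :
    t1 * t2 * t3 * (t4 * t5) = t2 * t5 * (t1 * t3 * t4) by ring.
  have regroup' (t1 t2 t3 t4 t5 t6 : R) :
    t1 * t2 * t3 * (t4 * t5 * t6) = t1 * t4 * t2 * t5 * (t3 * t6) by ring.
  by rewrite [LHS]regroup E regroup'.
rewrite nneseriesZl; last first.
  move=> k _; rewrite lee_fin; apply: mulr_ge0; last first.
    by rewrite divr_ge0// exprn_ge0// addr_ge0.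
  by apply: divr_ge0; apply/ltW/pochhammer_gt0; rewrite ltr_wpDr// ltr_wpDr.
rewrite kummerE ?addr_ge0//; last 2 first.
- by rewrite ltr_wpDr.
- by rewrite lerD2r lerDl.
by rewrite -EFinM /A; congr EFin; ring.
Qed.

End mixture_series.

(** * Integrals against densities and joint laws *)

Section density.
Local Open Scope ereal_scope.
Context d (T : measurableType d) (R : realType).
Variables (mu nu : {measure set T -> \bar R}) (q : T -> R).
Hypotheses (mq : measurable_fun setT q) (q0 : forall x, (0 <= q x)%R).
Hypothesis muE : forall A, measurable A -> mu A = \int[nu]_(x in A) (q x)%:E.

Import HBNNSimple.

Let integral_density_nnsfun (h : {nnsfun T >-> R}) :
  \int[mu]_x (h x)%:E = \int[nu]_x ((h x)%:E * (q x)%:E).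
Proof.
have mhq r : measurable_fun setT
    (fun x => (\1_(h @^-1` [set r]) x)%:E * (q x)%:E).
  by apply: emeasurable_funM; apply/measurable_EFinP.
have hq0 r x : 0 <= (\1_(h @^-1` [set r]) x)%:E * (q x)%:E :> \bar R.
  by rewrite mule_ge0 ?lee_fin.
rewrite integralT_nnsfun sintegralE.
transitivity (\int[nu]_x \sum_(r \in range h)
    r%:E * ((\1_(h @^-1` [set r]) x)%:E * (q x)%:E)); last first.
  apply: eq_integral => x _.
  rewrite [in RHS]fimfunE -fsumEFin// ge0_mule_fsuml; last first.
    by move=> r; exact: nnfun_muleindic_ge0.
  by apply: eq_fsbigr => r _; rewrite EFinM muleA.
have r0 r : r \in range h -> (0 <= r)%R by rewrite inE => -[x _ <-].
rewrite ge0_integral_fsum//; last 2 first.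
- by move=> r; exact: measurable_funeM.
- move=> r x _; have [r_ge0|r_lt0] := leP 0%R r; first by rewrite mule_ge0.
  by rewrite preimage_nnfun0// indic0 mul0e mule0.
apply: eq_fsbigr => r hr; rewrite ge0_integralZl//; last exact: r0.
congr (_ * _); rewrite muE// integral_mkcond; apply: eq_integral => x _.
by rewrite patchE indicE; case: ifPn => _; rewrite ?mul1e ?mul0e.
Qed.

(** Extension from indicator functions to simple functions by linearity, then to
nonnegative functions by monotone convergence. *)
Lemma integral_density (f : T -> \bar R) :
  measurable_fun setT f -> (forall x, 0 <= f x) ->
  \int[mu]_x f x = \int[nu]_x (f x * (q x)%:E).
Proof.
move=> mf f0; pose h := nnsfun_approx measurableT mf.
have cvgh x : (h n x)%:E @[n --> \oo] --> f x.
  by apply: cvg_nnsfun_approx.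
transitivity (limn (fun n => \int[mu]_x (h n x)%:E)).
  rewrite -monotone_convergence//.
  - by apply: eq_integral => x _; apply/esym/cvg_lim => //; exact: cvgh.
  - by move=> n; exact/measurable_EFinP.
  - by move=> n x _; rewrite lee_fin.
  - by move=> x _ m n mn; rewrite lee_fin; exact/lefP/nd_nnsfun_approx.
under eq_fun do rewrite integral_density_nnsfun.
rewrite -monotone_convergence//.
- apply: eq_integral => x _; apply/cvg_lim => //.
  by apply: cvgeZr => //; exact: cvgh.
- move=> n; apply: emeasurable_funM; exact/measurable_EFinP.
- by move=> n x _; rewrite mule_ge0 ?lee_fin.
- move=> x _ m n mn; rewrite lee_wpmul2r ?lee_fin//.
  exact/lefP/nd_nnsfun_approx.
Qed.

End density.

(** The Lebesgue measure is first transported, along the identity, to the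
measurable structure that random variables put on the real line. *)
Lemma integral_lebesgue_density (R : realType) (mu : {measure set R -> \bar R})
    (q : R -> R) (f : R -> \bar R) :
  measurable_fun setT q -> (forall x, 0 <= q x) ->
  (forall A, measurable A -> mu A = \int[lebesgue]_(x in A) (q x)%:E)%E ->
  measurable_fun setT f -> (forall x, 0 <= f x)%E ->
  (\int[mu]_x f x = \int[lebesgue]_x (f x * (q x)%:E))%E.
Proof.
move=> mq q0 muE mf f0.
pose idR : measurableTypeR R -> R := idfun.
have midR : measurable_fun setT idR by move=> _ A mA; rewrite setTI.
pose nu : {measure set R -> \bar R} := pushforward lebesgue idR.
have nuE A (g : R -> \bar R) : measurable A -> measurable_fun setT g ->
    (forall x, 0 <= g x)%E ->
    (\int[nu midR]_(x in A) g x = \int[lebesgue]_(x in A) g x)%E.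
  move=> mA mg g0.
  rewrite (@ge0_integral_pushforward _ _ _ _ _ idR midR lebesgue A g)//.
  exact: measurable_funTS.
have mqE : measurable_fun setT (fun x => (q x)%:E) by exact/measurable_EFinP.
rewrite (@integral_density _ R R mu (nu midR) q)//.
- by rewrite nuE// => [|x]; [exact: emeasurable_funM|rewrite mule_ge0 ?lee_fin].
- by move=> A mA; rewrite nuE// muE.
Qed.

Section independence.
Local Open Scope ereal_scope.
Context d d1 d2 (T : measurableType d) (T1 : measurableType d1)
  (T2 : measurableType d2) (R : realType) (P : probability T R).

(** Independence says that the joint law agrees with the product of the two laws
on rectangles, hence everywhere; then apply Tonelli. *)
Lemma integral_independent (X : {RV P >-> T1}) (Y : {RV P >-> T2})
    (f : T1 * T2 -> \bar R) :
  independent_RVs X Y -> measurable_fun setT f -> (forall z, 0 <= f z) ->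
  \int[P]_t f (X t, Y t) =
  \int[distribution P X]_x \int[distribution P Y]_y f (x, y).
Proof.
move=> indXY mf f0; pose XY t := (X t, Y t).
have mXY : measurable_fun setT XY by exact: measurable_fun_pair.
rewrite -(fubini_tonelli1 f)//.
rewrite -[LHS](@ge0_integral_pushforward _ _ _ _ _ XY mXY P setT f)//.
apply/esym/eq_measure_integral => A mA _.
by apply: product_measure_unique.
Qed.

End independence.

(** * Non-central chi-squared variables *)

Lemma poisson_prob1 (R : realType) (x : R) n k : 0 <= x ->
  poisson_prob x n [set k] = (poisson_weight x k)%:E.
Proof.
rewrite le_eqVlt => /predU1P[<-|x0]; rewrite /poisson_prob /poisson_weight.
  rewrite ltxx diracE oppr0 expR0 mulr1; congr EFin.
  case: k => [|k]; first by rewrite mem_set// expr0 fact0 divr1.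
  by rewrite memNset// exprS !mul0r.
rewrite x0 esum_set1; last by rewrite lee_fin poisson_pmf_ge0.
by rewrite /poisson_pmf x0.
Qed.

Lemma chi2_pdfE (R : realType) (p x : R) :
  chi2_pdf (2 * p) x =
  (2 `^ p * Gamma p)^-1 * (pos_powR p x * expR (- (2^-1 * x))).
Proof.
rewrite /chi2_pdf /pos_powR; case: ifPn => x0; last by rewrite mul0r mulr0.
have -> : 2 * p / 2 = p by field.
by rewrite [RHS]mulrC mulNr [x / 2]mulrC.
Qed.

Lemma chi2_pdf_ge0 (R : realType) (p x : R) : 0 < p -> 0 <= chi2_pdf (2 * p) x.
Proof.
move=> p0; rewrite chi2_pdfE; apply: mulr_ge0.
  by rewrite invr_ge0 mulr_ge0 ?powR_ge0// ltW// Gamma_gt0.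
by rewrite mulr_ge0 ?pos_powR_ge0 ?expR_ge0.
Qed.

Lemma measurable_chi2_pdf (R : realType) (p : R) :
  measurable_fun setT (chi2_pdf (2 * p)).
Proof.
rewrite (_ : chi2_pdf _ = fun x =>
    (2 `^ p * Gamma p)^-1 * (pos_powR p x * expR (- (2^-1 * x)))).
  apply: measurable_funM => //; apply/measurable_EFinP.
  exact: measurable_gamma_integrand.
by apply/funext => x; exact: chi2_pdfE.
Qed.

Section noncentral_chi2.
Local Open Scope ereal_scope.
Context d (T : measurableType d) (R : realType) (P : probability T R).

(** The law of Y is the sum over k of its restrictions to the events M = k, and
the k-th restriction has a density, namely the Poisson weight of k times a
chi-squared density. *)
Lemma integral_noncentral_chi2 (Y : {RV P >-> R}) (a l : R) (f : R -> \bar R) :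
  (0 < a)%R -> (0 <= l)%R -> noncentral_chi2 Y (2 * a) l ->
  measurable_fun setT f -> (forall x, 0 <= f x) ->
  \int[distribution P Y]_x f x =
  \sum_(k <oo) (poisson_weight (l / 2) k)%:E *
    \int[lebesgue]_x (f x * (chi2_pdf (2 * (a + k%:R)) x)%:E).
Proof.
move=> a0 l0 [M [MP YM]] mf f0.
have l20 : (0 <= l / 2)%R by rewrite divr_ge0.
have mM k : measurable (M @^-1` [set k]).
  by rewrite -[X in measurable X]setTI; exact: measurable_funP.
have mY A : measurable A -> measurable (Y @^-1` A).
  by move=> mA; rewrite -[X in measurable X]setTI; exact: measurable_funP.
have PM k : P (M @^-1` [set k]) = (poisson_weight (l / 2) k)%:E.
  by rewrite -(poisson_prob1 0%N)// -MP.
pose mYk : measurable_fun setT Y := measurable_funP Y.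
(* The law of Y restricted to the event M = k. *)
pose m k : {measure set R -> \bar R} := pushforward (mrestr P (mM k)) Y.
transitivity (\int[mseries (m mYk) 0]_x f x).
  apply: eq_measure_integral => A mA _.
  transitivity (\sum_(k <oo) P (Y @^-1` A `&` M @^-1` [set k])); last by [].
  rewrite -measure_semi_bigcup.
  - congr (P _); apply/seteqP; split => t /=; last by case=> k _ [].
    by move=> At; exists (M t).
  - by move=> k; apply: measurableI => //; exact: mY.
  - move=> i j _ _ [t [[_ /= ti] [_ /= tj]]]; by rewrite -ti -tj.
  - by apply: bigcup_measurable => k _; apply: measurableI => //; exact: mY.
rewrite ge0_integral_measure_series//; apply: eq_eseriesr => k _.
have ak0 : (0 < a + k%:R)%R by rewrite ltr_wpDr.
have mpdf := measurable_chi2_pdf (a + k%:R).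
have pdf0 x := chi2_pdf_ge0 x ak0.
rewrite (@integral_lebesgue_density R (m mYk k)
  (fun x => poisson_weight (l / 2) k * chi2_pdf (2 * (a + k%:R)) x)%R)//.
- under eq_integral do rewrite EFinM muleCA.
  rewrite lebesgue_integralZl//.
  + by rewrite lee_fin poisson_weight_ge0.
  + by apply: emeasurable_funM => //; exact/measurable_EFinP.
  + by move=> x; rewrite mule_ge0// lee_fin.
- exact: measurable_funM.
- by move=> x; rewrite mulr_ge0// poisson_weight_ge0.
- move=> A mA.
  transitivity (P (M @^-1` [set k] `&` Y @^-1` A)); first by rewrite setIC.
  rewrite YM// PM /chi2_law -mulrDr.
  under [RHS]eq_integral do rewrite EFinM.
  rewrite ge0_integralZl//.
  + by apply: measurable_funTS; exact/measurable_EFinP.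
  + by move=> x _; rewrite lee_fin.
  + by rewrite lee_fin poisson_weight_ge0.
Qed.

End noncentral_chi2.

(** The ratio U / (U + V) of independent chi-squared variables with 2p and 2q
degrees of freedom is Beta(p, q): the Dirichlet-type formula for the weight
e^(-(u+v)/2), whose gamma-type factor, together with the normalizing constants
of the two chi-squared laws, is the normalizing constant of the beta law. *)
Lemma integral_chi2_ratio (R : realType) (p q : R) (f : R -> R) :
  0 < p -> 0 < q -> measurable_fun setT f -> (forall x, 0 <= f x) ->
  (\int[lebesgue]_u
     (\int[lebesgue]_v ((f (u / (u + v)))%:E * (chi2_pdf (2 * q) v)%:E) *
      (chi2_pdf (2 * p) u)%:E) =
   \int[lebesgue]_x (f x * beta_density p q x)%:E)%E.
Proof.
move=> p0 q0 mf f0; have pq0 : 0 < p + q by rewrite addr_gt0.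
pose C (s : R) := (2 `^ s * Gamma s)^-1.
have C0 s : 0 < s -> 0 <= C s.
  by move=> s0; rewrite invr_ge0 mulr_ge0 ?powR_ge0// ltW// Gamma_gt0.
(* The normalizing constants go into the function of u + v. *)
pose phi (s : R) := C p * C q * expR (- (2^-1 * s)).
have mphi : measurable_fun setT phi.
  apply: measurable_funM => //; apply: measurableT_comp => //.
  by apply: measurableT_comp => //; exact: measurable_funM.
have phi0 s : 0 <= phi s by rewrite mulr_ge0 ?expR_ge0// mulr_ge0 ?C0.
have := dirichlet_integral p q mphi phi0 mf f0.
under [X in (_ = X * _)%E -> _]eq_integral => s _.
  rewrite (_ : _ * _ =
    C p * C q * (pos_powR (p + q) s * expR (- (2^-1 * s)))); last first.
    by rewrite /phi; ring.
  rewrite EFinM; over.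
rewrite lebesgue_integralZl; last 3 first.
- by rewrite lee_fin mulr_ge0 ?C0.
- exact: measurable_gamma_integrand.
- by move=> s; exact: gamma_integrand_ge0.
rewrite gamma_integral_rate// gamma_integralE// -!EFinM => H.
transitivity (\int[lebesgue]_u \int[lebesgue]_v
    (pos_powR p u * pos_powR q v * phi (u + v) * f (u / (u + v)))%:E)%E.
  apply: eq_integral => u _.
  rewrite muleC -lebesgue_integralZl.
  - apply: eq_integral => v _; rewrite -!EFinM; congr EFin.
    by rewrite !chi2_pdfE /phi mulrDr opprD expRD /C; ring.
  - by rewrite lee_fin chi2_pdf_ge0.
  - apply/measurable_EFinP.
    apply: measurable_funM; last exact: measurable_chi2_pdf.
    apply: (measurableT_comp mf); apply: measurable_funM => //.
    by apply: (measurableT_comp (@measurable_invr R)); exact: measurable_funD.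
  - by move=> v; rewrite mule_ge0 ?lee_fin ?chi2_pdf_ge0.
rewrite H -lebesgue_integralZl.
- apply: eq_integral => x _; rewrite -EFinM; congr EFin.
  have half (s : R) : (2^-1 : R) `^ (- s) = 2 `^ s.
    by rewrite -powR_inv1// -powRrM mulN1r opprK.
  rewrite beta_densityE BetaE// /beta_kernel /C half powRD_gt0//.
  have := Gamma_gt0 p0; have := Gamma_gt0 q0; have := Gamma_gt0 pq0.
  have := powR_gt0 p (ltr0n R 2); have := powR_gt0 q (ltr0n R 2).
  move: (Gamma p) (Gamma q) (Gamma (p + q)) (2 `^ p) (2 `^ q) => A1 A2 A3 A4 A5 *.
  by field; rewrite !gt_eqF.
- rewrite lee_fin; apply: mulr_ge0; first by rewrite mulr_ge0 ?C0.
  by rewrite mulr_ge0 ?powR_ge0// ltW// Gamma_gt0.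
- apply/measurable_EFinP; apply: measurable_funM => //.
  exact: measurable_beta_kernel.
- by move=> x; rewrite lee_fin !mulr_ge0 ?pos_powR_ge0.
Qed.

(** * The mixture representation of the doubly non-central beta law *)

Lemma lebesgue_integral_nneseries (R : realType) (f : nat -> R -> \bar R) :
  (forall n, measurable_fun setT (f n)) -> (forall n x, 0 <= f n x)%E ->
  (\int[lebesgue]_x (\sum_(n <oo) f n x) =
   \sum_(n <oo) \int[lebesgue]_x f n x)%E.
Proof. by move=> mf f0; exact: integral_nneseries. Qed.

Section DNcB_mixture.
Local Open Scope ereal_scope.
Context (R : realType) (a1 a2 l1 l2 : R).
Hypotheses (a1_gt0 : (0 < a1)%R) (a2_gt0 : (0 < a2)%R).
Hypotheses (l1_ge0 : (0 <= l1)%R) (l2_ge0 : (0 <= l2)%R).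

(** X has the law of a function of (Y1, Y2), so its integral is an iterated one
over the laws of Y1 and Y2; each of these laws is expanded along its Poisson index,
and the remaining double integral is one over a beta law. *)
Lemma integral_DNcB d (T : measurableType d) (P : probability T R)
    (X : {RV P >-> R}) (f : R -> R) :
  DNcB X a1 a2 l1 l2 -> measurable_fun setT f -> (forall x, 0 <= f x)%R ->
  \int[P]_t (f (X t))%:E =
  \sum_(m <oo) \sum_(n <oo)
    (poisson_weight (l1 / 2) m * poisson_weight (l2 / 2) n)%:E *
    \int[lebesgue]_x (f x * beta_density (a1 + m%:R) (a2 + n%:R) x)%:E.
Proof.
move=> [d' [T' [P' [Y1 [Y2 [Y1l Y2l indY XP]]]]]] mf f0.
have w1 m : (0 <= poisson_weight (l1 / 2) m)%R.
  by rewrite poisson_weight_ge0// divr_ge0.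
have w2 n : (0 <= poisson_weight (l2 / 2) n)%R.
  by rewrite poisson_weight_ge0// divr_ge0.
have a1m m : (0 < a1 + m%:R)%R by rewrite ltr_wpDr.
have a2n n : (0 < a2 + n%:R)%R by rewrite ltr_wpDr.
pose F (z : R * R) := (f (z.1 / (z.1 + z.2)))%:E.
have F0 z : 0 <= F z by rewrite lee_fin.
have mF : measurable_fun setT F.
  apply/measurable_EFinP; apply: (measurableT_comp mf).
  apply: measurable_funM => //.
  by apply: (measurableT_comp (@measurable_invr R)); exact: measurable_funD.
have mfE : measurable_fun setT (fun x => (f x)%:E) by exact/measurable_EFinP.
pose Z t := (Y1 t / (Y1 t + Y2 t))%R.
have mZ : measurable_fun setT Z.
  apply: measurable_funM => //.
  by apply: (measurableT_comp (@measurable_invr R)); exact: measurable_funD.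
transitivity (\int[P']_t F (Y1 t, Y2 t)).
  transitivity (\int[distribution P X]_x (f x)%:E).
    by rewrite ge0_integral_distribution.
  transitivity (\int[pushforward P' Z]_x (f x)%:E).
    by apply: eq_measure_integral => A mA _; exact: XP.
  rewrite (@ge0_integral_pushforward _ _ _ _ _ Z mZ P' setT)// => x _.
  by rewrite lee_fin.
rewrite (integral_independent indY mF F0).
rewrite (integral_noncentral_chi2 a1_gt0 l1_ge0 Y1l); first last.
- by move=> u; exact: integral_ge0.
- exact: (@measurable_fun_fubini_tonelli_F _ _ _ _ _ (distribution P' Y2) F mF).
apply: eq_eseriesr => m _.
(* Integral over v when the second Poisson index is n. *)
pose Psi n u := \int[lebesgue]_v (F (u, v) * (chi2_pdf (2 * (a2 + n%:R)) v)%:E).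
have Psi0 n u : 0 <= Psi n u.
  by apply: integral_ge0 => v _; rewrite mule_ge0// lee_fin chi2_pdf_ge0.
have mPsi n : measurable_fun setT (Psi n).
  apply: (@measurable_fun_fubini_tonelli_F _ _ _ _ _ lebesgue
    (fun z => F z * (chi2_pdf (2 * (a2 + n%:R)) z.2)%:E)).
  - apply: emeasurable_funM => //; apply/measurable_EFinP.
    exact: (measurableT_comp (measurable_chi2_pdf (a2 + n%:R))).
  - by move=> z; rewrite mule_ge0// lee_fin chi2_pdf_ge0.
have pdf0 u := chi2_pdf_ge0 u (a1m m).
have mpdf : measurable_fun setT (fun u => (chi2_pdf (2 * (a1 + m%:R)) u)%:E).
  by apply/measurable_EFinP; exact: measurable_chi2_pdf.
transitivity ((poisson_weight (l1 / 2) m)%:E *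
  \sum_(n <oo) (poisson_weight (l2 / 2) n)%:E *
    \int[lebesgue]_u (Psi n u * (chi2_pdf (2 * (a1 + m%:R)) u)%:E)).
  congr (_ * _).
  transitivity (\int[lebesgue]_u \sum_(n <oo) (poisson_weight (l2 / 2) n)%:E *
      (Psi n u * (chi2_pdf (2 * (a1 + m%:R)) u)%:E)).
    apply: eq_integral => u _.
    rewrite (integral_noncentral_chi2 a2_gt0 l2_ge0 Y2l); first last.
    - by move=> v; exact: F0.
    - exact: (measurableT_comp mF (measurable_pair1 u)).
    rewrite muleC -nneseriesZl; last by move=> n _; rewrite mule_ge0 ?lee_fin ?Psi0.
    by apply: eq_eseriesr => n _; rewrite muleCA [X in _ * X]muleC.
  rewrite lebesgue_integral_nneseries.
  - apply: eq_eseriesr => n _; rewrite lebesgue_integralZl ?lee_fin//.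
      exact: emeasurable_funM.
    by move=> u; rewrite mule_ge0 ?lee_fin.
  - by move=> n; apply: measurable_funeM; exact: emeasurable_funM.
  - by move=> n u; rewrite !mule_ge0 ?lee_fin.
rewrite -nneseriesZl; last first.
  move=> n _; rewrite mule_ge0 ?lee_fin//; apply: integral_ge0 => u _.
  by rewrite mule_ge0 ?lee_fin.
apply: eq_eseriesr => n _; rewrite muleA -EFinM; congr (_ * _).
exact: integral_chi2_ratio.
Qed.

End DNcB_mixture.

(** * Moments *)

Section expectation.
Context d (T : measurableType d) (R : realType) (P : probability T R).

(** The integral formulas above are for nonnegative functions, while nothing
forbids X to be negative on a null event.  The moments are therefore computed from
the positive part, once the negative part is known to integrate to 0. *)
Lemma expectation_pos_part (X : T -> R) :
  (\int[P]_t (Num.max (- X t) 0)%:E = 0)%E ->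
  ('E_P[X] = \int[P]_t (Num.max (X t) 0)%:E)%E.
Proof.
move=> X0; rewrite unlock integralE.
rewrite (_ : integral P setT (fun t => (EFin \o X)^\- t)%E = 0%E) ?sube0; last first.
  by rewrite -[RHS]X0; apply: eq_integral => t _; rewrite funenegE EFin_max EFinN.
by apply: eq_integral => t _; rewrite funeposE EFin_max.
Qed.

End expectation.

Lemma beta_density_ge0 (R : realType) (p q x : R) : 0 < p -> 0 < q ->
  0 <= beta_density p q x.
Proof.
move=> p0 q0; have pq0 : 0 < p + q by rewrite addr_gt0.
rewrite beta_densityE; apply: divr_ge0; first exact: beta_kernel_ge0.
rewrite BetaE//.
by apply/ltW/divr_gt0; [apply: mulr_gt0|]; exact: Gamma_gt0.
Qed.

Lemma measurable_beta_density (R : realType) (p q : R) :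
  measurable_fun setT (beta_density p q).
Proof.
rewrite (_ : beta_density p q = fun x => beta_kernel p q x / Beta p q).
  by apply: measurable_funM => //; exact: measurable_beta_kernel.
by apply/funext => x; exact: beta_densityE.
Qed.

Section moments.
Context {R : realType} (p q : R) (r : nat).
Hypotheses (p0 : 0 < p) (q0 : 0 < q).

Lemma beta_moment_pos_part :
  (\int[lebesgue]_x (Num.max (x ^+ r) 0 * beta_density p q x)%:E =
   (pochhammer p r / pochhammer (p + q) r)%:E)%E.
Proof.
rewrite -beta_moment//; apply: eq_integral => x _; congr EFin.
rewrite /beta_density; case: ifPn => [/andP[x0 _]|_]; last by rewrite !mulr0.
by rewrite max_l// exprn_ge0// ltW.
Qed.

Lemma beta_moment_neg_part :
  (\int[lebesgue]_x (Num.max (- x ^+ r) 0 * beta_density p q x)%:E = 0)%E.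
Proof.
apply: integral0_eq => x _.
rewrite /beta_density; case: ifPn => [/andP[x0 _]|_]; last by rewrite mulr0.
by rewrite max_r ?mul0r// oppr_le0 exprn_ge0// ltW.
Qed.

End moments.

Lemma expectation_beta (R : realType) d (T : measurableType d)
    (P : probability T R) (X : {RV P >-> R}) (p q : R) (r : nat) :
  0 < p -> 0 < q -> has_law X (beta_law p q) ->
  'E_P[fun t => (X t ^+ r)%R]%E = (pochhammer p r / pochhammer (p + q) r)%:E.
Proof.
move=> p0 q0 XP.
have lawE (f : R -> R) : measurable_fun setT f -> (forall x, 0 <= f x) ->
    (\int[P]_t (f (X t))%:E =
     \int[lebesgue]_x (f x * beta_density p q x)%:E)%E.
  move=> mf f0; have mfE : measurable_fun setT (fun x => (f x)%:E).
    exact/measurable_EFinP.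
  transitivity (\int[distribution P X]_x (f x)%:E)%E.
    by rewrite ge0_integral_distribution// => x; rewrite lee_fin.
  rewrite (@integral_lebesgue_density R (distribution P X) (beta_density p q))//.
  - exact: measurable_beta_density.
  - by move=> x; exact: beta_density_ge0.
have mX : measurable_fun setT (fun x : R => x ^+ r) by exact: measurable_funX.
rewrite expectation_pos_part.
  rewrite (lawE (fun x => Num.max (x ^+ r) 0)) ?beta_moment_pos_part//.
    exact: measurable_maxr.
  by move=> x; rewrite le_max lexx orbT.
rewrite (lawE (fun x => Num.max (- x ^+ r) 0)) ?beta_moment_neg_part//.
  by apply: measurable_maxr => //; exact: measurableT_comp.
by move=> x; rewrite le_max lexx orbT.
Qed.

Unset Implicit Arguments.

Theorem proposition4p2 (R : realType) (a1 a2 l1 l2 : R)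
    (ha1 : 0 < a1) (ha2 : 0 < a2) (hl1 : 0 <= l1) (hl2 : 0 <= l2)
    (d : measure_display) (T : measurableType d) (P : probability T R)
    (X : {RV P >-> R}) (hX : DNcB X a1 a2 l1 l2)
    (r : nat) (hr : (1 <= r)%N) :
  let ap := a1 + a2 in
  let lp := l1 + l2 in
  ('E_P[fun t => (X t ^+ r)%R]%E =
    (pochhammer a1 r / pochhammer ap r * expR (- (lp / 2)) *
     \sum_(i < r.+1)
       ('C(r, i)%:R * pochhammer ap i * (l1 / 2) ^+ i /
        (pochhammer a1 i * pochhammer (ap + r%:R) i) *
        kummer (ap + i%:R) (ap + r%:R + i%:R) (lp / 2)))%:E) /\
  (forall (d' : measure_display) (T' : measurableType d')
      (Q : probability T' R) (B : {RV Q >-> R}),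
    has_law B (beta_law a1 a2) ->
    'E_Q[fun t => (B t ^+ r)%R]%E = (pochhammer a1 r / pochhammer ap r)%:E).
Proof.
move=> ap lp; split; last first.
  by move=> d' T' Q B; exact: expectation_beta.
have mX : measurable_fun setT (fun x : R => x ^+ r) by exact: measurable_funX.
have a1m m : 0 < a1 + m%:R by rewrite ltr_wpDr.
have a2n n : 0 < a2 + n%:R by rewrite ltr_wpDr.
have lawE f := integral_DNcB (f := f) ha1 ha2 hl1 hl2 hX.
rewrite expectation_pos_part.
  rewrite (lawE (fun x => Num.max (x ^+ r) 0)); first last.
  - by move=> x; rewrite le_max lexx orbT.
  - exact: measurable_maxr.
  rewrite /lp mulrDl -mixture_series ?divr_ge0//.
  apply: eq_eseriesr => m _; apply: eq_eseriesr => n _.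
  by rewrite beta_moment_pos_part// -EFinM.
rewrite (lawE (fun x => Num.max (- x ^+ r) 0)); first last.
- by move=> x; rewrite le_max lexx orbT.
- by apply: measurable_maxr => //; exact: measurableT_comp.
apply: eseries0 => m _ _; apply: eseries0 => n _ _.
by rewrite beta_moment_neg_part// mule0.
Qed.
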